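(* Let $\mathcal I=(i_-,i_+)\subseteq\mathbb R$ and let $X$ be a random variable with an absolutely continuous density $f$ satisfying $f(x)>0$ for $x\in\mathcal I$. Let $F(x)=\int_{i_-}^x f(y)\,dy$, let $\bar x$ be the median ($F(\bar x)=1/2$), and define $$K(x)=\frac{F(x)}{f(x)}\ \text{ if } x\le\bar x,\qquad K(x)=\frac{1-F(x)}{f(x)}\ \text{ if } x\ge \bar x .$$ Then for every $1\le p<\infty$ and every smooth $\phi$ on $\mathcal I$ with $E[|\phi(X)|^p]<\infty$, $$E\big[|\phi(X)-E(\phi(X))|^p\big]\le (2p)^p\,E\big[K(X)^p|\phi'(X)|^p\big].$$ *)

(* Defs.v *)
From HB Require Import structures.
From mathcomp Require Import all_boot all_order all_algebra.
From mathcomp Require Import all_classical all_reals all_analysis.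

Set Implicit Arguments.
Unset Strict Implicit.
Unset Printing Implicit Defensive.

Import Order.TTheory GRing.Theory Num.Theory.
Import numFieldNormedType.Exports.

Local Open Scope classical_set_scope.
Local Open Scope ring_scope.

Section defs.
Variable R : realType.

Definition open_itv (a b : \bar R) : set R :=
  [set x : R | (a < x%:E)%E /\ (x%:E < b)%E].

Definition cdf_from (a : \bar R) (f : R -> R) (x : R) : R :=
  fine (\int[lebesgue_measure]_(y in [set y : R | (a < y%:E)%E /\ (y <= x)%R])
          (f y)%:E)%E.

(* K(x) = F(x)/f(x) if x <= xbar, (1 - F(x))/f(x) if x >= xbar
   (the two formulas agree at x = xbar since F(xbar) = 1/2). *)
Definition Kfun (a : \bar R) (f : R -> R) (xbar : R) (x : R) : R :=
  if x <= xbar then cdf_from a f x / f x else (1 - cdf_from a f x) / f x.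

Definition abs_cont_on (f : R -> R) (u v : R) : Prop :=
  forall eps : R, 0 < eps -> exists2 delta : R, 0 < delta &
    forall (n : nat) (s t : nat -> R),
      (forall k, (k < n)%N -> u <= s k /\ s k <= t k /\ t k <= v) ->
      (forall k, (k.+1 < n)%N -> t k <= s k.+1) ->
      \sum_(k < n) (t k - s k) < delta ->
      \sum_(k < n) `|f (t k) - f (s k)| < eps.

Definition loc_abs_cont_on (I : set R) (f : R -> R) : Prop :=
  forall u v : R, I u -> I v -> abs_cont_on f u v.

Definition smooth_on (I : set R) (phi : R -> R) : Prop :=
  forall (n : nat) (x : R), I x -> derivable (derive1n n phi) x 1.

End defs.

(* Main.v *)
(** Put psi := phi - phi(xbar).  By convexity of [t^p] and Jensen's inequality,
    [E|phi(X) - E phi(X)|^p = E|psi(X) - E psi(X)|^p <= 2^p E|psi(X)|^p], so it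
    suffices to prove the Hardy inequality
    [int |psi|^p f <= p^p int K^p |psi'|^p f] on each side of the median.  There
    [K f = |g|] with [g = -F] on the left, [g = 1 - F] on the right, and [g' = -f].
    Young's inequality gives the pointwise bound
    [|psi|^p f + (p |psi|^p g)' <= p^p K^p |psi'|^p f].  Integrating it over a compact
    segment ending at the median, the boundary term has the favourable sign because
    [psi] vanishes there, and the segments exhaust the interval.  To cover [p = 1],
    [|psi|] is regularised to [(psi^2 + e)^(1/2)], and [e] tends to 0. *)

Require Import Defs.
From HB Require Import structures.
From mathcomp Require Import all_boot all_order all_algebra.
From mathcomp Require Import all_classical all_reals all_analysis.
From mathcomp Require Import measurable_realfun ring lra.

Set Implicit Arguments.
Unset Strict Implicit.
Unset Printing Implicit Defensive.

Import Order.TTheory GRing.Theory Num.Theory.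
Import numFieldNormedType.Exports.

Local Open Scope classical_set_scope.
Local Open Scope ring_scope.

(** * Pointwise convexity inequalities for real powers *)

Section pointwise.
Context {R : realType}.
Implicit Types (p t a k e u v f g : R).

(** Young's inequality for the product of [t] and 1 with exponents [p] and [p / (p - 1)], cleared of
    denominators. At [p = 1] the conjugate exponent degenerates and the two sides coincide. *)
Lemma bernoulli_powR p t : 1 <= p -> 0 <= t -> p * t <= p - 1 + t `^ p.
Proof.
move=> p1 t0; have p0 : 0 < p by rewrite (lt_le_trans _ p1).
have [->|pn1] := eqVneq p 1; first by rewrite powRr1// subrr add0r mul1r.
have pB0 : 0 < p - 1 by rewrite subr_gt0 lt_neqAle eq_sym pn1.
have := @conjugate_powR R t 1 p (p / (p - 1)) t0 ler01 p0 (divr_gt0 p0 pB0).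
rewrite mulr1 powR1 mul1r invf_div -[X in X + _ = _]mul1r -mulrDl subrKC.
rewrite divff ?gt_eqF// => /(_ erefl).
by rewrite -mulrDl ler_pdivlMr// mulrC addrC.
Qed.

(** The graph of [t^p] lies above its tangent at [a]; obtained from [bernoulli_powR] at [t / a],
    scaled by [a^p]. It serves below as convexity, as Young's inequality and as the core of Jensen's
    inequality. *)
Lemma tangent_powR p a t : 1 <= p -> 0 < a -> 0 <= t ->
  p * t * a `^ (p - 1) <= (p - 1) * a `^ p + t `^ p.
Proof.
move=> p1 a0 t0; have p0 : 0 < p by rewrite (lt_le_trans _ p1).
have := @bernoulli_powR p (t / a) p1 (divr_ge0 t0 (ltW a0)).
rewrite -(ler_pM2r (powR_gt0 p a0)) mulrDl.
rewrite -[X in _ + X]powRM ?divr_ge0 ?(ltW a0)// divfK ?gt_eqF//.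
apply: le_trans; rewrite -(mulr_powRB1 (ltW a0) p0) le_eqVlt.
by apply/orP; left; apply/eqP; field; rewrite gt_eqF.
Qed.

Lemma norm_powRB_le p u v : 1 <= p ->
  `|u - v| `^ p <= 2 `^ (p - 1) * (`|u| `^ p + `|v| `^ p).
Proof.
move=> p1; have p0 : 0 < p by rewrite (lt_le_trans _ p1).
have [s0|s0] := eqVneq (`|u| + `|v|) 0.
  have /eqP u0 : `|u| == 0 by rewrite eq_le normr_ge0 -s0 lerDl normr_ge0.
  have /eqP v0 : `|v| == 0 by rewrite eq_le normr_ge0 -s0 lerDr normr_ge0.
  rewrite (normr0_eq0 u0) (normr0_eq0 v0) subr0 normr0 powR0 ?(gt_eqF p0)//.
have {}s0 : 0 < `|u| + `|v| by rewrite lt0r s0 addr_ge0.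
pose a := (`|u| + `|v|) / 2; have a0 : 0 < a by rewrite divr_gt0.
apply: (@le_trans _ _ ((2 * a) `^ p)).
  rewrite ge0_ler_powR ?nnegrE ?mulr_ge0 ?(ltW a0) ?(ltW p0)//.
  by rewrite /a mulrC divfK// ler_normB.
rewrite powRM ?(ltW a0)// -(@mulr_powRB1 _ 2 p)// mulrAC.
rewrite mulrC ler_pM2l ?powR_gt0//.
have := tangent_powR p1 a0 (normr_ge0 u); have := tangent_powR p1 a0 (normr_ge0 v).
(* Since [a] is the midpoint of [|u|] and [|v|], adding the two tangent bounds leaves
   [2 a^p <= |u|^p + |v|^p]. *)
have : p * `|u| * a `^ (p - 1) + p * `|v| * a `^ (p - 1) = 2 * p * a `^ p.
  by rewrite -(mulr_powRB1 (ltW a0) p0) /a; field.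
lra.
Qed.

(** When [u' = v] and [g' = - f], the second summand is the derivative of [p (u^2 + e)^(p/2) g].
    With [a = (u^2 + e)^(1/2)], the tangent bound at [a] for [t = p k |v|], multiplied by [f],
    controls it, because [|u| <= a] and [|g| = f k]. Positivity of [e] keeps the base positive, as
    the exponent [p/2 - 1] may be negative. *)
Lemma hardy_pointwise p e u v f g k : 1 <= p -> 0 < e -> 0 <= f -> 0 <= k ->
  `|g| = f * k ->
  (u ^+ 2 + e) `^ (p / 2) * f +
    p * (p * (u ^+ 2 + e) `^ (p / 2 - 1) * u * v * g - (u ^+ 2 + e) `^ (p / 2) * f)
  <= p `^ p * (k `^ p * `|v| `^ p) * f.
Proof.
move=> p1 e0 f0 k0 gE; have p0 : 0 < p by rewrite (lt_le_trans _ p1).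
set s := u ^+ 2 + e; have s0 : 0 < s by rewrite ltr_wpDl// sqr_ge0.
pose a := s `^ 2^-1; have a0 : 0 < a by rewrite powR_gt0.
have ua : `|u| <= a.
  by rewrite /a powR12_sqrt ?(ltW s0)// -sqrtr_sqr ler_wsqrtr// lerDl ltW.
have -> : s `^ (p / 2) = a `^ p by rewrite -powRrM mulrC.
have sa : s `^ (p / 2 - 1) * a = a `^ (p - 1).
  by rewrite -powRrM /a -powRD ?(gt_eqF s0) ?implybT//; congr powR; field.
have kv0 : 0 <= k * `|v| by rewrite mulr_ge0.
have := tangent_powR p1 a0 (mulr_ge0 (ltW p0) kv0).
rewrite powRM ?(ltW p0)// powRM// => /(ler_wpM2r f0).
suff : p * (p * s `^ (p / 2 - 1) * u * v * g) <=
       p * (p * (k * `|v|)) * a `^ (p - 1) * f by nra.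
rewrite -sa.
have -> : p * (p * (k * `|v|)) * (s `^ (p / 2 - 1) * a) * f =
  (p * p * s `^ (p / 2 - 1) * `|v| * (f * k)) * a by ring.
have : (p * p * s `^ (p / 2 - 1) * `|v| * (f * k)) * `|u| <=
       (p * p * s `^ (p / 2 - 1) * `|v| * (f * k)) * a.
  by apply: ler_wpM2l => //; rewrite !mulr_ge0 ?(ltW p0) ?powR_ge0.
apply: le_trans; rewrite -gE (le_trans (ler_norm _))// !normrM.
rewrite (ger0_norm (ltW p0)) (ger0_norm (powR_ge0 _ _)).
by rewrite le_eqVlt; apply/orP; left; apply/eqP; ring.
Qed.
End pointwise.

(** * The regularised Hardy inequality on a compact segment *)

Section hardy_segment.
Context {R : realType}.
Notation mu := (@lebesgue_measure R).

Lemma within_continuous_pointwise (a b : R) (h : R -> R) :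
  (forall x, x \in `[a, b] -> {for x, continuous h}) ->
  {within `[a, b], continuous h}.
Proof.
by move=> ch; apply: continuous_in_subspaceT => x; rewrite inE /=; exact: ch.
Qed.

Lemma continuous_segment_integrable (a b : R) (h : R -> R) :
  (forall x, x \in `[a, b] -> {for x, continuous h}) ->
  mu.-integrable `[a, b] (EFin \o h).
Proof.
move=> ch; apply: continuous_compact_integrable; first exact: segment_compact.
exact: within_continuous_pointwise.
Qed.

Lemma FTC2_segment (a b : R) (W w : R -> R) : a < b ->
  (forall x, x \in `[a, b] -> is_derive x (1 : R) W (w x)) ->
  (forall x, x \in `[a, b] -> {for x, continuous w}) ->
  (\int[mu]_(x in `[a, b]) (w x)%:E = (W b - W a)%:E)%E.
Proof.
move=> ab dW cw; rewrite EFinB; apply: continuous_FTC2 => //.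
- exact: within_continuous_pointwise.
- have cW x : x \in `[a, b] -> {for x, continuous W}.
    move=> /dW [dWx _]; apply: differentiable_continuous.
    exact/derivable1_diffP.
  split.
  + move=> x xab; have [] // := dW x; exact: subset_itv_oo_cc xab.
  + apply: cvg_at_right_filter; apply: cW.
    by rewrite in_itv/= lexx ltW.
  + apply: cvg_at_left_filter; apply: cW.
    by rewrite in_itv/= lexx ltW.
- move=> x xab; rewrite derive1E.
  by have [_ ->] := dW x (subset_itv_oo_cc xab).
Qed.

(** [hardy_pointwise] is integrated and its derivative term becomes the explicit boundary term. The
    regularisation survives only there, since [|u|^p <= (u^2 + e)^(p/2)] removes it from the
    integral on the left. *)
Lemma hardy_segment (a b p e : R) (f g k u v : R -> R) :
  a < b -> 1 <= p -> 0 < e ->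
  (forall x, x \in `[a, b] -> 0 <= f x) ->
  (forall x, x \in `[a, b] -> 0 <= k x) ->
  (forall x, x \in `[a, b] -> `|g x| = f x * k x) ->
  (forall x, x \in `[a, b] -> {for x, continuous f}) ->
  (forall x, x \in `[a, b] -> {for x, continuous v}) ->
  (forall x, x \in `[a, b] -> is_derive x (1 : R) g (- f x)) ->
  (forall x, x \in `[a, b] -> is_derive x (1 : R) u (v x)) ->
  measurable_fun `[a, b] k ->
  (\int[mu]_(x in `[a, b]) (`|u x| `^ p * f x)%:E +
     (p * (u b ^+ 2 + e) `^ (p / 2) * g b
      - p * (u a ^+ 2 + e) `^ (p / 2) * g a)%:E <=
   \int[mu]_(x in `[a, b]) (p `^ p * (k x `^ p * `|v x| `^ p) * f x)%:E)%E.
Proof.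
move=> ab p1 e0 f0 k0 gE cf cv dg du mk.
pose W x := p * (u x ^+ 2 + e) `^ (p / 2) * g x; rewrite -/(W a) -/(W b).
have p0 : 0 < p by rewrite (lt_le_trans _ p1).
have sgt0 x : 0 < u x ^+ 2 + e by rewrite ltr_wpDl// sqr_ge0.
pose q x := (u x ^+ 2 + e) `^ (p / 2) * f x.
pose w x := p * (p * (u x ^+ 2 + e) `^ (p / 2 - 1) * u x * v x * g x - q x).
have cg x : x \in `[a, b] -> {for x, continuous g}.
  by move=> /dg [dx _]; exact/differentiable_continuous/derivable1_diffP.
have cu x : x \in `[a, b] -> {for x, continuous u}.
  by move=> /du [dx _]; exact/differentiable_continuous/derivable1_diffP.
have cs c x : x \in `[a, b] ->
    {for x, continuous (fun y => (u y ^+ 2 + e) `^ c)}.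
  move=> xab.
  have cu2 : {for x, continuous (fun y => u y ^+ 2 + e)}.
    apply: continuousD; last exact: cst_continuous.
    by apply: (@continuousM _ _ u u); exact: cu.
  have cp : {for u x ^+ 2 + e, continuous (@powR R ^~ c)}.
    have [dx _] := @is_derive1_powR R c _ (sgt0 x).
    exact/differentiable_continuous/derivable1_diffP.
  exact: (continuous_comp cu2 cp).
have cq x : x \in `[a, b] -> {for x, continuous q}.
  by move=> xab; apply: continuousM; [exact: cs|exact: cf].
have cw x : x \in `[a, b] -> {for x, continuous w}.
  move=> xab; apply: continuousM; first exact: cst_continuous.
  apply: continuousB; last exact: cq.
  apply: continuousM; last exact: cg.
  apply: continuousM; last exact: cv.
  apply: continuousM; last exact: cu.
  by apply: continuousM; [exact: cst_continuous|exact: cs].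
have dW x : x \in `[a, b] -> is_derive x (1 : R) W (w x).
  move=> xab; have dgx := dg x xab; have dux := du x xab.
  have dpx := @is_derive1_powR R (p / 2) _ (sgt0 x).
  have dsx : is_derive x (1 : R) (fun y => u y ^+ 2 + e) (2 * u x * v x).
    rewrite [X in is_derive _ _ X](_ : _ = (u * u + cst e)); last first.
      by apply/funext => y /=; rewrite expr2.
    apply: is_derive_eq.
    by rewrite addr0 /GRing.scale/=; ring.
  have dc := @is_derive1_comp R _ (fun y => u y ^+ 2 + e) x _ _ dpx dsx.
  rewrite [X in is_derive _ _ X](_ : _ =
    cst p * ((@powR R ^~ (p / 2)) \o (fun y => u y ^+ 2 + e)) * g); last first.
    by apply/funext.
  apply: is_derive_eq.
  rewrite /w /q /= scaler0 addr0 /GRing.scale/= !fctE /=.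
  by field.
have mu_u : measurable_fun `[a, b] u.
  by apply: subspace_continuous_measurable_fun => //; exact: within_continuous_pointwise.
have mv : measurable_fun `[a, b] v.
  by apply: subspace_continuous_measurable_fun => //; exact: within_continuous_pointwise.
have mfu : measurable_fun `[a, b] f.
  by apply: subspace_continuous_measurable_fun => //; exact: within_continuous_pointwise.
have iq := continuous_segment_integrable cq.
have iw := continuous_segment_integrable cw.
rewrite -(FTC2_segment ab dW cw).
(* Replace [|u|^p f] by the larger function [q], which is continuous and so integrable, in order to
   merge it with [w]. *)
apply: (@le_trans _ _
  (\int[mu]_(x in `[a, b]) (q x)%:E + \int[mu]_(x in `[a, b]) (w x)%:E)%E).
  rewrite leeD2r//; apply: ge0_le_integral => //=.
  - by move=> x xab; rewrite lee_fin mulr_ge0 ?powR_ge0 ?f0.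
  - apply/measurable_EFinP/measurable_funM => //.
    apply: (measurableT_comp (measurable_powR p)).
    exact: measurableT_comp.
  - by move/integrableP : iq => [].
  - move=> x xab; rewrite lee_fin ler_wpM2r ?f0//.
    rewrite mulrC powRrM ge0_ler_powR ?nnegrE ?powR_ge0 ?(ltW p0)//.
    rewrite powR12_sqrt ?(ltW (sgt0 x))// -sqrtr_sqr ler_wsqrtr// lerDl.
    exact: ltW.
rewrite -integralD//=.
set r := (X in (_ <= \int[mu]_(x in _) X x)%E).
have r0 x : x \in `[a, b] -> (0 <= r x)%E.
  by move=> xab; rewrite lee_fin !mulr_ge0 ?powR_ge0 ?f0.
have mr : measurable_fun `[a, b] r.
  apply/measurable_EFinP/measurable_funM => //; apply: measurable_funM => //.
  apply: measurable_funM; apply: (measurableT_comp (measurable_powR p)) => //.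
  exact: measurableT_comp.
(* The integrand [q + w] may change sign, so comparing integrals requires [r] to be integrable; if
   its integral is infinite the bound is trivial. *)
have [ry|rfin] := eqVneq (\int[mu]_(x in `[a, b]) r x)%E +oo%E.
  by rewrite ry leey.
apply: le_integral => //=.
- exact: integrableD.
- apply/integrableP; split => //.
  rewrite (@eq_integral _ _ _ _ _ r) => [|x]; last first.
    by rewrite inE => xab; rewrite gee0_abs// r0.
  by rewrite ltey.
- move=> x; rewrite inE/= => xab; rewrite lee_fin.
  by apply: hardy_pointwise; rewrite ?f0 ?k0 ?gE.
Qed.
End hardy_segment.

(** * Removal of the regularisation *)

Section hardy_vanishing.
Context {R : realType}.
Notation mu := (@lebesgue_measure R).

Lemma hardy_segment_vanishing (a b p : R) (f g k u v : R -> R) :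
  a < b -> 1 <= p ->
  (forall x, x \in `[a, b] -> 0 <= f x) ->
  (forall x, x \in `[a, b] -> 0 <= k x) ->
  (forall x, x \in `[a, b] -> `|g x| = f x * k x) ->
  (forall x, x \in `[a, b] -> {for x, continuous f}) ->
  (forall x, x \in `[a, b] -> {for x, continuous v}) ->
  (forall x, x \in `[a, b] -> is_derive x (1 : R) g (- f x)) ->
  (forall x, x \in `[a, b] -> is_derive x (1 : R) u (v x)) ->
  measurable_fun `[a, b] k ->
  (u a = 0 /\ 0 <= g b) \/ (u b = 0 /\ g a <= 0) ->
  (\int[mu]_(x in `[a, b]) (`|u x| `^ p * f x)%:E <=
   \int[mu]_(x in `[a, b]) (p `^ p * (k x `^ p * `|v x| `^ p) * f x)%:E)%E.
Proof.
move=> ab p1 f0 k0 gE cf cv dg du mk ends.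
have p0 : 0 < p by rewrite (lt_le_trans _ p1).
apply/lee_addgt0Pr => d d0.
pose M := p * (`|g a| + `|g b| + 1).
have M0 : 0 < M by rewrite mulr_gt0// ltr_wpDl// addr_ge0.
(* chosen so that the boundary term at the zero of [u] is at most [d] *)
pose e := (d / M) `^ (2 / p).
have e0 : 0 < e by rewrite powR_gt0// divr_gt0.
have eE : e `^ (p / 2) = d / M.
  have E : 2 / p * (p / 2) = 1 by field; rewrite gt_eqF.
  by rewrite /e -powRrM E powRr1// divr_ge0 ?ltW.
have := hardy_segment ab p1 e0 f0 k0 gE cf cv dg du mk.
rewrite -leeBrDr// => /le_trans; apply; rewrite leeD2l// -EFinN lee_fin lerNl.
have dM : p * (d / M) * (`|g a| + `|g b| + 1) = d.
  by rewrite /M; field; rewrite !gt_eqF// ltr_wpDl// addr_ge0.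
have dM0 : 0 <= p * (d / M) by rewrite mulr_ge0// ?divr_ge0// ltW.
have := ler_norm (g a); have := ler_norm (- g b); rewrite normrN => gb ga.
have sp x : 0 <= p * (u x ^+ 2 + e) `^ (p / 2) by rewrite mulr_ge0 ?powR_ge0// ltW.
have n1 := normr_ge0 (g a); have n2 := normr_ge0 (g b).
case: ends => -[uz gz].
- have := mulr_ge0 (sp b) gz; rewrite uz expr0n/= add0r eE; nra.
- have := mulr_ge0_le0 (sp a) gz; rewrite uz expr0n/= add0r eE; nra.
Qed.
End hardy_vanishing.

(** * Open intervals with extended endpoints: topology, exhaustion, continuity *)

Section open_itv.
Context {R : realType}.
Implicit Types (a b : \bar R) (x y : R).

Lemma open_open_itv a b : open (open_itv a b).
Proof.
have -> : open_itv a b = [set x | (a < x%:E)%E] `&` [set x | (x%:E < b)%E] by [].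
apply: openI.
- case: a => [r| |].
  + by rewrite (_ : [set _ | _] = [set x | r < x])//; exact: open_gt.
  + rewrite (_ : [set _ | _] = set0); first exact: open0.
    by apply/seteqP; split=> x //=; rewrite ltNge leey.
  + rewrite (_ : [set _ | _] = setT); first exact: openT.
    by apply/seteqP; split=> x //= _; rewrite ltNyr.
- case: b => [r| |].
  + by rewrite (_ : [set _ | _] = [set x | x < r])//; exact: open_lt.
  + rewrite (_ : [set _ | _] = setT); first exact: openT.
    by apply/seteqP; split=> x //= _; rewrite ltry.
  + rewrite (_ : [set _ | _] = set0); first exact: open0.
    by apply/seteqP; split=> x //=; rewrite ltNge leNye.
Qed.

Lemma measurable_open_itv a b : measurable (open_itv a b).
Proof. by have := @open_measurable R _ (@open_open_itv a b). Qed.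

Lemma open_itv_segment a b x y z :
  open_itv a b x -> open_itv a b y -> z \in `[x, y] -> open_itv a b z.
Proof.
move=> [ax _] [_ yb]; rewrite in_itv/= => /andP[xz zy]; split.
- by rewrite (lt_le_trans ax)// lee_fin.
- by rewrite (le_lt_trans _ yb)// lee_fin.
Qed.

Lemma open_itv_around a b x : open_itv a b x ->
  exists2 e : R, 0 < e & forall y, `|x - y| <= e -> open_itv a b y.
Proof.
move=> Ix; have /nbhs_ballP[e /= e0 eI] : nbhs x (open_itv a b).
  by apply: open_nbhs_nbhs; split => //; exact: open_open_itv.
exists (e / 2); first by rewrite divr_gt0.
move=> y xy; apply: eI; rewrite /ball/=.
by rewrite (le_lt_trans xy)// ltr_pdivrMr// ltr_pMr// ltr1n.
Qed.

Lemma upper_exhaustion b x : (x%:E < b)%E ->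
  exists2 u : nat -> R, {homo u : m n / (m <= n)%N >-> m <= n} &
    (forall n, x < u n /\ ((u n)%:E < b)%E) /\
    (forall y, (y%:E < b)%E -> exists n, y <= u n).
Proof.
case: b => [r| |]; last by rewrite ltNge leNye.
(* The denominator starts at 2, so that already the first point lies strictly above [x]. *)
- rewrite lte_fin => xr; exists (fun n => r - (r - x) / n.+2%:R).
    move=> m n mn; rewrite lerD2l lerN2 ler_pM2l ?subr_gt0//.
    by rewrite lef_pV2 ?posrE// ler_nat !ltnS.
  split.
    move=> n; split.
      rewrite ltrBrDl -ltrBrDr ltr_pdivrMr// ltr_pMr ?subr_gt0//.
      by rewrite ltr1n.
    by rewrite lte_fin gtrBl divr_gt0// subr_gt0.
  move=> y; rewrite lte_fin => yr.
  (* The condition [y <= u n] amounts to [(r - x) / (r - y) <= n + 2]. *)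
  exists (Num.truncn ((r - x) / (r - y))).
  rewrite lerBrDl -lerBrDr ler_pdivrMr// mulrC -ler_pdivrMr ?subr_gt0//.
  rewrite (le_trans (ltW (truncnS_gt _)))// ler_nat//.
- move=> _; exists (fun n => x + n.+1%:R).
    by move=> m n mn; rewrite lerD2l ler_nat ltnS.
  split; first by move=> n; rewrite ltrDl ltr0n ltry.
  move=> y _; exists (Num.truncn (y - x)).
  by rewrite -lerBlDl (le_trans (ltW (truncnS_gt _))).
Qed.

Lemma lower_exhaustion a x : (a < x%:E)%E ->
  exists2 u : nat -> R, {homo u : m n / (m <= n)%N >-> n <= m} &
    (forall n, u n < x /\ (a < (u n)%:E)%E) /\
    (forall y, (a < y%:E)%E -> exists n, u n <= y).
Proof.
move=> ax; have : ((- x)%:E < - a)%E by rewrite EFinN lteN2.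
move=> /upper_exhaustion[u ndu [ub cu]]; exists (fun n => - u n).
  by move=> m n mn; rewrite lerN2 ndu.
split.
  move=> n; have [ux ua] := ub n; split; first by rewrite ltrNl.
  by rewrite EFinN lteNr.
move=> y ay; have [n yn] := cu (- y) ltac:(by rewrite EFinN lteN2).
by exists n; rewrite lerNl.
Qed.

(** Families made of a single interval already give uniform continuity on [[x - r, x + r]].
    Continuity of the density then makes the distribution function differentiable at every point of
    the interval. *)
Lemma abs_cont_continuous a b (f : R -> R) :
  loc_abs_cont_on (open_itv a b) f ->
  forall x, open_itv a b x -> {for x, continuous f}.
Proof.
move=> acf x Ix; have [r r0 rI] := open_itv_around Ix.
have Iu : open_itv a b (x - r) by apply: rI; rewrite subKr gtr0_norm.
have Iv : open_itv a b (x + r) by apply: rI; rewrite opprD addNKr normrN gtr0_norm.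
apply/cvgrPdist_lt => eps eps0.
have [delta delta0 H] := acf _ _ Iu Iv eps eps0.
have K (s t : R) : x - r <= s -> s <= t -> t <= x + r -> t - s < delta ->
    `|f t - f s| < eps.
  move=> us st tv ts.
  have := H 1%N (fun=> s) (fun=> t); rewrite !big_ord1; apply => //.
near=> y.
have yr : `|x - y| < r by near: y; exact: cvgr_dist_lt.
have yd : `|x - y| < delta by near: y; exact: cvgr_dist_lt.
move: yr yd; rewrite !ltr_norml => /andP[y1 y2] /andP[y3 y4].
have [xy|yx] := leP x y.
- by rewrite -ltr_norml distrC; apply: K => //; lra.
- by rewrite -ltr_norml; apply: K; lra.
Unshelve. all: by end_near. Qed.
End open_itv.

(** * The distribution function: bounds and derivative *)

Section cdf.
Context {R : realType}.
Notation mu := (@lebesgue_measure R).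
Variables (im : \bar R) (f : R -> R).
Hypothesis mf : measurable_fun setT f.
Hypothesis f0 : forall x, 0 <= f x.
Hypothesis f1 : (\int[mu]_x (f x)%:E = 1)%E.

(** Presents the integration set of [cdf_from] as an interval, the form required by the fundamental
    theorem of calculus; [BRight] excludes a finite left endpoint. *)
Let left_bound : itv_bound R :=
  match im with r%:E => BRight r | -oo => -oo%O | +oo => +oo%O end%E.

Let cdf_setE x : [set y : R | (im < y%:E)%E /\ y <= x] =
  [set` Interval left_bound (BRight x)].
Proof.
apply/seteqP; split => y /=; rewrite /left_bound in_itv/=; case: im => [r| |]//=.
- by rewrite lte_fin => -[-> ->].
- by rewrite ltNge leey => -[].
- by move=> [_ ->].
- by rewrite lte_fin => /andP[].
- by move=> yx; rewrite ltNyr.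
Qed.

Let mcdf_set x : measurable [set y : R | (im < y%:E)%E /\ y <= x].
Proof. by rewrite cdf_setE; exact: measurable_itv. Qed.

Let integrable_density : mu.-integrable setT (EFin \o f).
Proof.
apply/integrableP; split; first exact/measurable_EFinP.
under eq_integral do rewrite gee0_abs ?lee_fin ?f0//.
by rewrite f1 ltry.
Qed.

Let cdf_integral_le1 x :
  (\int[mu]_(y in [set y : R | (im < y%:E)%E /\ (y <= x)%R]) (f y)%:E <= 1)%E.
Proof.
rewrite -f1; apply: ge0_subset_integral => //=.
- exact: mcdf_set.
- exact/measurable_EFinP.
- by move=> y _; rewrite lee_fin.
Qed.

Lemma cdf_from_ge0 x : 0 <= cdf_from im f x.
Proof. by apply: fine_ge0; apply: integral_ge0 => y _; rewrite lee_fin. Qed.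

Lemma cdf_from_le1 x : cdf_from im f x <= 1.
Proof.
(* The integral is at most the total mass 1, hence finite, so [fine] returns its true value. *)
rewrite -lee_fin fineK ?cdf_integral_le1// ge0_fin_numE.
  by rewrite (le_lt_trans (cdf_integral_le1 x))// ltry.
by apply: integral_ge0 => y _; rewrite lee_fin.
Qed.

Lemma is_derive_cdf_from x : (im < x%:E)%E -> {for x, continuous f} ->
  is_derive x (1 : R) (cdf_from im f) (f x).
Proof.
move=> imx cfx.
(* Any right end beyond [x] would do; [x + 1] puts [x] in the interior, where the fundamental
   theorem applies. *)
have intf : mu.-integrable [set` Interval left_bound (BRight (x + 1))] (EFin \o f).
  by apply: integrableS integrable_density => //; exact: measurable_itv.
have FE : cdf_from im f =
    (fun x => \int[mu]_(t in [set` Interval left_bound (BRight x)]) f t)%R.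
  by apply/funext => y; rewrite /cdf_from cdf_setE.
have ax : (left_bound < BRight x)%E.
  by move: imx; rewrite /left_bound; case: im => [r| |]//; rewrite lte_fin.
have [dF F'] := @continuous_FTC1 R f _ x (x + 1) ltac:(by rewrite ltrDl) intf ax cfx.
by rewrite FE; apply: DeriveDef => //; rewrite -F' derive1E.
Qed.
End cdf.

(** * The Hardy inequality across the median *)

Section hardy_median.
Context {R : realType}.
Notation mu := (@lebesgue_measure R).

Lemma ge0_integral_segment_split (a c b : R) (h : R -> \bar R) :
  a < c -> c < b -> measurable_fun `[a, b] h ->
  (forall x, x \in `[a, b] -> 0 <= h x)%E ->
  (\int[mu]_(x in `[a, b]) h x =
   \int[mu]_(x in `[a, c]) h x + \int[mu]_(x in `[c, b]) h x)%E.
Proof.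
move=> ac cb mh h0.
have E : `[a, b]%classic = `[a, c]%classic `|` `]c, b]%classic.
  by apply: itv_bndbnd_setU; rewrite bnd_simp ltW.
rewrite E ge0_integral_setU//.
- rewrite integral_itv_obnd_cbnd//; apply: measurable_funS mh => //.
  by apply: subset_itvr; rewrite bnd_simp ltW.
- by rewrite -E.
- by move=> x; rewrite -E; exact: h0.
- apply/disj_setPS => x /= []; rewrite !in_itv/= => /andP[_ xc] /andP[cx _].
  by move: (lt_le_trans cx xc); rewrite ltxx.
Qed.

Variables (im ip : \bar R) (f : R -> R) (xbar p : R) (u v : R -> R).
Let I := open_itv im ip.
Let F := cdf_from im f.
Let K := Kfun im f xbar.
Hypothesis mf : measurable_fun setT f.
Hypothesis f0 : forall x, 0 <= f x.
Hypothesis f1 : (\int[mu]_x (f x)%:E = 1)%E.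
Hypothesis fpos : forall x, I x -> 0 < f x.
Hypothesis cf : forall x, I x -> {for x, continuous f}.
Hypothesis Ixbar : I xbar.
Hypothesis Fxbar : F xbar = 1 / 2.

Lemma Kfun_ge0 x : 0 <= K x.
Proof.
rewrite /K /Kfun; case: ifPn => _; rewrite divr_ge0//.
- exact: cdf_from_ge0.
- by rewrite subr_ge0 cdf_from_le1.
Qed.

Let dF x : I x -> is_derive x (1 : R) F (f x).
Proof. by move=> Ix; apply: is_derive_cdf_from => //; [case: Ix|exact: cf]. Qed.

Let measurable_continuous_itv (h : R -> R) :
  (forall x, I x -> {for x, continuous h}) -> measurable_fun I h.
Proof.
move=> ch; apply: open_continuous_measurable_fun; first exact: open_open_itv.
by move=> x; rewrite inE; exact: ch.
Qed.

Lemma measurable_Kfun : measurable_fun I K.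
Proof.
have mF : measurable_fun I F.
  apply: measurable_continuous_itv => x /dF[dFx _].
  exact/differentiable_continuous/derivable1_diffP.
have mfV : measurable_fun I (fun x => (f x)^-1).
  apply: measurable_continuous_itv => x Ix; apply: continuousV; last exact: cf.
  by rewrite gt_eqF// fpos.
rewrite /K (_ : Kfun _ _ _ = fun x =>
    (if x <= xbar then F x else 1 - F x) * (f x)^-1); last first.
  by apply/funext => x; rewrite /Kfun; case: ifPn.
apply: measurable_funM => //; apply: measurable_fun_if.
- exact: measurable_open_itv.
- by apply: measurable_funTS; apply: measurable_fun_ler.
- by apply: measurable_funS mF => //; exact: measurable_open_itv.
- apply: measurable_funB => //.
  by apply: measurable_funS mF => //; exact: measurable_open_itv.
Qed.

Hypothesis p1 : 1 <= p.
Hypothesis du : forall x, I x -> is_derive x (1 : R) u (v x).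
Hypothesis cv : forall x, I x -> {for x, continuous v}.
Hypothesis uxbar : u xbar = 0.

Let lhs x := (`|u x| `^ p * f x)%:E.
Let rhs x := (p `^ p * (K x `^ p * `|v x| `^ p) * f x)%:E.

Let mlhs : measurable_fun I lhs.
Proof.
apply/measurable_EFinP/measurable_funM; last exact: measurable_funTS.
apply: (measurableT_comp (measurable_powR p)); apply: measurableT_comp => //.
apply: measurable_continuous_itv => x /du[dx _].
exact/differentiable_continuous/derivable1_diffP.
Qed.

Let mrhs : measurable_fun I rhs.
Proof.
apply/measurable_EFinP/measurable_funM; last exact: measurable_funTS.
apply: measurable_funM => //; apply: measurable_funM.
  exact: (measurableT_comp (measurable_powR p) measurable_Kfun).
apply: (measurableT_comp (measurable_powR p)); apply: measurableT_comp => //.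
exact: measurable_continuous_itv.
Qed.

Let lhs0 x : (0 <= lhs x)%E.
Proof. by rewrite lee_fin mulr_ge0 ?powR_ge0. Qed.

Let rhs0 x : (0 <= rhs x)%E.
Proof. by rewrite lee_fin !mulr_ge0 ?powR_ge0. Qed.

Let measurable_segment (h : R -> \bar R) a b : I a -> I b ->
  measurable_fun I h -> measurable_fun `[a, b] h.
Proof.
move=> Ia Ib; apply: measurable_funS; first exact: measurable_open_itv.
by move=> x /= ; exact: open_itv_segment.
Qed.

(** On either side of [xbar] the chosen [g] satisfies [g' = - f] and [|g| = f K]. Its sign at the
    outer endpoint follows from [0 <= F <= 1], while [u] vanishes at the inner one. *)
Lemma hardy_median_segment a b : I a -> I b -> a < xbar -> xbar < b ->
  (\int[mu]_(x in `[a, b]) lhs x <= \int[mu]_(x in `[a, b]) rhs x)%E.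
Proof.
move=> Ia Ib ax xb.
rewrite !(@ge0_integral_segment_split a xbar b)//;
  [|exact: measurable_segment..].
have mK c d : I c -> I d -> measurable_fun `[c, d] K.
  move=> Ic Id; apply: measurable_funS measurable_Kfun; first exact: measurable_open_itv.
  by move=> x /= ; exact: open_itv_segment.
apply: leeD.
- have sI x : x \in `[a, xbar] -> I x by exact: open_itv_segment.
  apply: (@hardy_segment_vanishing _ _ _ _ _ (fun x => - F x)) => //.
  + by move=> x _; exact: Kfun_ge0.
  + move=> x xax; rewrite normrN ger0_norm; last exact: cdf_from_ge0.
    rewrite /K /Kfun; move: (xax); rewrite in_itv/= => /andP[_ ->].
    by rewrite mulrC divfK// gt_eqF// fpos//; exact: sI.
  + by move=> x /sI; exact: cf.
  + by move=> x /sI; exact: cv.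
  + by move=> x /sI /dF dFx; exact: is_deriveN.
  + by move=> x /sI; exact: du.
  + exact: mK.
  + by right; rewrite oppr_le0; split => //; exact: cdf_from_ge0.
- have sI x : x \in `[xbar, b] -> I x by exact: open_itv_segment.
  apply: (@hardy_segment_vanishing _ _ _ _ _ (fun x => 1 - F x)) => //.
  + by move=> x _; exact: Kfun_ge0.
  + move=> x xax; rewrite ger0_norm; last by rewrite subr_ge0 cdf_from_le1.
    rewrite /K /Kfun; move: (xax); rewrite in_itv/= => /andP[xx _].
    rewrite mulrC; case: ifPn => [xx'|_]; last first.
      by rewrite divfK// gt_eqF// fpos//; exact: sI.
    (* At the median itself [Kfun] takes its left branch; [F xbar = 1/2] makes it agree with the
       right one. *)
    have -> : x = xbar by apply/eqP; rewrite eq_le xx' xx.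
    by rewrite divfK ?gt_eqF ?fpos// -/F Fxbar; field.
  + by move=> x /sI; exact: cf.
  + by move=> x /sI; exact: cv.
  + move=> x /sI /dF dFx; have := is_deriveB (is_derive_cst (1 : R) x (1 : R)) dFx.
    by rewrite sub0r.
  + by move=> x /sI; exact: du.
  + exact: mK.
  + by left; rewrite subr_ge0; split => //; exact: cdf_from_le1.
Qed.

Lemma hardy_median : (\int[mu]_(x in I) lhs x <= \int[mu]_(x in I) rhs x)%E.
Proof.
case: (Ixbar) => imx xip.
have [a nia [aI ca]] := lower_exhaustion imx.
have [b ndb [bI cb]] := upper_exhaustion xip.
have Ia n : I (a n).
  by have [ax ia] := aI n; split=> //; rewrite (lt_trans _ xip)// lte_fin.
have Ib n : I (b n).
  by have [xb bi] := bI n; split=> //; rewrite (lt_trans imx)// lte_fin.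
have E : I = \bigcup_n `[a n, b n]%classic.
  apply/seteqP; split => [x [ix xi]|x [n _]]; last exact: (open_itv_segment (Ia n) (Ib n)).
  have [m am] := ca _ ix; have [n bn] := cb _ xi.
  exists (maxn m n) => //=; rewrite in_itv/=; apply/andP; split.
    by rewrite (le_trans _ am)// nia// leq_maxl.
  by rewrite (le_trans bn)// ndb// leq_maxr.
have nd : nondecreasing_seq (fun n => `[a n, b n]%classic).
  move=> m n mn; apply/subsetPset => x /=; rewrite !in_itv/= => /andP[ax xb].
  by rewrite (le_trans (nia _ _ mn))//= (le_trans xb)// ndb.
(* Monotone convergence along the increasing segments, for nonnegative integrands whose integral
   over [I] may be infinite. *)
have cvg h : measurable_fun I h -> (forall x, 0 <= h x)%E ->
    (\int[mu]_(x in `[a i, b i]) h x @[i --> \oo] --> \int[mu]_(x in I) h x)%E.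
  move=> mh h0; rewrite E; apply: ge0_nondecreasing_set_cvg_integral => //.
  by move=> n; exact: measurable_segment.
apply: (lee_cvg_to (cvg _ mlhs lhs0) (cvg _ mrhs rhs0)).
apply: nearW => n; apply: hardy_median_segment => //.
- by have [] := aI n.
- by have [] := bI n.
Qed.
End hardy_median.

(** * Integrals over sets of full measure and against a density *)

Section integral_lemmas.
Local Open Scope ereal_scope.
Context {d : measure_display} {T : measurableType d} {R : realType}.
Implicit Types mu nu : {measure set T -> \bar R}.

Import HBNNSimple.

(* For non-measurable [h] the library's integral is the lower integral, a supremum
   over simple functions, each of which can be multiplied by the indicator of [A]. *)
Lemma ge0_integral_full_set mu (A : set T) (h : T -> \bar R) :
  measurable A -> mu (~` A) = 0 -> (forall x, 0 <= h x) ->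
  \int[mu]_x h x = \int[mu]_(x in A) h x.
Proof.
move=> mA muA h0; rewrite ge0_integralTE// ge0_integralE//.
apply/eqP; rewrite eq_le; apply/andP; split.
- apply: ge_ereal_sup => /= _ [g /= gh <-].
  have -> : sintegral mu g = sintegral mu (g \_ A).
    rewrite -integral_nnsfun//; transitivity (\int[mu]_x (g x)%:E).
      by rewrite integral_nnsfun// patch_setT.
    rewrite (@ge0_negligible_integral _ _ _ mu setT (~` A))//.
    + by rewrite setTD setCK.
    + exact: measurableC.
    + exact/measurable_EFinP/measurable_funTS.
    + by move=> x _; rewrite lee_fin.
  apply: ereal_sup_ubound => /=.
  exists (mul_nnsfun g (indic_nnsfun R mA)).
    move=> x /=; rewrite patchE mindicE; case: ifPn => xA; first by rewrite mulr1.
    by rewrite mulr0.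
  by rewrite mrestrict.
- apply: ge_ereal_sup => /= _ [g /= gh <-].
  apply: ereal_sup_ubound => /=; exists g => // x.
  by rewrite (le_trans (gh x))// patchE; case: ifPn.
Qed.

(** Measurability of [h] is not assumed because [phi] is regular only on the open interval, so
    [phi \o X] may fail to be measurable off the event that [X] lies there. *)
Lemma integral_full_set mu (A : set T) (h : T -> \bar R) :
  measurable A -> mu (~` A) = 0 -> \int[mu]_x h x = \int[mu]_(x in A) h x.
Proof.
move=> mA muA; rewrite integralE [RHS]integralE.
by congr (_ - _); exact: ge0_integral_full_set.
Qed.

(** Monotone convergence under both measures reduces the claim to the simple approximations [h_ n],
    and linearity reduces those to indicators, where it is the hypothesis on [nu]. *)
Lemma ge0_integral_density mu nu (f : T -> R) (D : set T) (h : T -> \bar R) :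
  measurable_fun setT f -> (forall x, (0 <= f x)%R) ->
  (forall A, measurable A -> nu A = \int[mu]_(x in A) (f x)%:E) ->
  measurable D -> measurable_fun D h -> (forall x, D x -> 0 <= h x) ->
  \int[nu]_(x in D) h x = \int[mu]_(x in D) (h x * (f x)%:E).
Proof.
move=> mf f0 nuE mD mh h0.
pose h_ := nnsfun_approx mD mh.
have cvg_h x : D x -> (h_ n x)%:E @[n --> \oo] --> h x.
  by move=> Dx; apply: cvg_nnsfun_approx.
have nd_h x m n : (m <= n)%N -> (h_ m x <= h_ n x)%R.
  by move=> mn; exact/lefP/nd_nnsfun_approx.
transitivity (limn (fun n => \int[nu]_(x in D) (h_ n x)%:E)).
  rewrite -monotone_convergence//.
  - by apply: eq_integral => x /[!inE] xD; apply/esym/cvg_lim => //; exact: cvg_h.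
  - by move=> n; exact/measurable_EFinP/measurable_funTS.
  - by move=> n x _; rewrite lee_fin.
  - by move=> x _ m n mn; rewrite lee_fin; exact: nd_h.
rewrite [X in limn X](_ : _ =
    (fun n => \int[mu]_(x in D) ((h_ n x)%:E * (f x)%:E))).
  rewrite -monotone_convergence//; last 3 first.
  - move=> n; apply: emeasurable_funM; apply/measurable_EFinP/measurable_funTS => //.
  - by move=> n x _; rewrite mule_ge0// lee_fin.
  - by move=> x _ m n mn; rewrite lee_wpmul2r// lee_fin//; exact: nd_h.
  apply: eq_integral => x /[!inE] xD; apply/cvg_lim => //.
  by apply: cvgeZr => //; exact: cvg_h.
apply/funext => n.
have mk k : measurable (h_ n @^-1` [set k]) by exact: measurable_sfunP.
(* Both integrals become finite sums over the values [k] of [h_ n]; each summand is [k] times the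
   integral of [f] over the part of [D] where [h_ n = k]. *)
under eq_integral do rewrite fimfunE -fsumEFin//.
rewrite ge0_integral_fsum//; last 2 first.
- by move=> y; exact/measurable_EFinP/measurable_funM.
- by move=> y x _; rewrite nnfun_muleindic_ge0.
under [RHS]eq_integral => x _.
  rewrite (fimfunE (h_ n)) -fsumEFin// ge0_mule_fsuml; last first.
    by move=> y; rewrite nnfun_muleindic_ge0.
  over.
rewrite ge0_integral_fsum//; last 2 first.
- move=> y; apply: emeasurable_funM; last exact/measurable_EFinP/measurable_funTS.
  exact/measurable_EFinP/measurable_funM.
- by move=> y x _; rewrite mule_ge0 ?(lee_fin _ (f x))// nnfun_muleindic_ge0.
apply: eq_fsbigr => k /[!inE] -[z _ hz].
have k0 : (0 <= k)%R by rewrite -hz.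
rewrite integralZl_indic_nnsfun// integral_indic//=.
under [RHS]eq_integral do rewrite EFinM -muleA.
rewrite ge0_integralZl//; last 2 first.
- apply: emeasurable_funM; last exact/measurable_EFinP/measurable_funTS.
  exact/measurable_EFinP.
- by move=> x _; rewrite mule_ge0// lee_fin.
rewrite nuE; last exact: measurableI.
congr (_ * _); rewrite setIC integral_mkcondr; apply: eq_integral => x _.
by rewrite patchE indicE; case: ifPn => _; rewrite ?mul1e ?mul0e.
Qed.
End integral_lemmas.

(** * Transfer of expectations to integrals against the density *)

Section probability_transfer.
Local Open Scope ereal_scope.
Context {d d' : measure_display} {T : measurableType d} {T' : measurableType d'}
  {R : realType}.

Lemma ge0_integral_comp_density (P : {measure set T -> \bar R})
    (mu : {measure set T' -> \bar R}) (X : T -> T') (f : T' -> R)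
    (D : set T') (h : T' -> \bar R) :
  measurable_fun setT X -> measurable_fun setT f -> (forall x, (0 <= f x)%R) ->
  (forall A, measurable A -> P (X @^-1` A) = \int[mu]_(x in A) (f x)%:E) ->
  measurable D -> measurable_fun D h -> (forall x, D x -> 0 <= h x) ->
  \int[P]_(w in X @^-1` D) h (X w) = \int[mu]_(x in D) (h x * (f x)%:E).
Proof.
move=> mX mf f0 PE mD mh h0.
pose X' : {mfun T >-> T'} := HB.pack X (isMeasurableFun.Build _ _ _ _ _ mX).
rewrite -(@ge0_integral_density _ _ _ mu (pushforward P X') f)//.
by rewrite [RHS]ge0_integral_pushforward// => x /[!inE]; exact: h0.
Qed.
End probability_transfer.

(** * Moments about the mean and about an arbitrary constant *)

Section centered_moment.
Context {d : measure_display} {T : measurableType d} {R : realType}.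
Variables (P : {measure set T -> \bar R}) (D : set T) (p : R).
Hypothesis mD : measurable D.
Hypothesis PD : P D = 1%E.
Hypothesis p1 : 1 <= p.

Let p0 : 0 < p. Proof. exact: lt_le_trans p1. Qed.

Let mpow (Y : T -> R) : measurable_fun D Y ->
  measurable_fun D (fun w => (`|Y w| `^ p)%:E).
Proof.
move=> mY; apply/measurable_EFinP/(measurableT_comp (measurable_powR p)).
exact: measurableT_comp.
Qed.

Let integrable_cstD (c : R) : P.-integrable D (EFin \o cst c).
Proof.
apply/integrableP; split; first exact/measurable_EFinP/measurable_cst.
by rewrite /= integral_cst// PD mule1 ltry.
Qed.

(** Domination by [1 + |Y|^p], a consequence of the Bernoulli bound. It makes the mean finite, so
    that [fine] of it is the genuine expectation. *)
Lemma integrable_of_moment (Y : T -> R) : measurable_fun D Y ->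
  (\int[P]_(w in D) (`|Y w| `^ p)%:E < +oo)%E -> P.-integrable D (EFin \o Y).
Proof.
move=> mY fin; have ip : P.-integrable D (fun w => (`|Y w| `^ p)%:E).
  apply/integrableP; split; first exact: mpow.
  by under eq_integral do rewrite /= ger0_norm ?powR_ge0//.
apply: (le_integrable mD _ _ (integrableD mD (integrable_cstD 1) ip)).
  exact/measurable_EFinP.
move=> w _ /=; rewrite lee_fin [leRHS]ger0_norm ?addr_ge0 ?powR_ge0//.
rewrite -(ler_pM2l p0) (le_trans (bernoulli_powR p1 (normr_ge0 (Y w))))//.
have := powR_ge0 `|Y w| p; have : 0 <= p - 1 by rewrite subr_ge0.
by nra.
Qed.

(** Let [n] be the mean of [|Y|]. Integrating the tangent bound at [n] gives
    [p n^p <= (p - 1) n^p + E|Y|^p], and [|E Y| <= n]. The case [n = 0] is separate because the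
    point of tangency must be positive. *)
Lemma jensen_norm_powR (Y : T -> R) : P.-integrable D (EFin \o Y) ->
  ((`|fine (\int[P]_(w in D) (Y w)%:E)| `^ p)%:E <=
   \int[P]_(w in D) (`|Y w| `^ p)%:E)%E.
Proof.
move=> iY; have mY : measurable_fun D Y by move/integrableP: iY => [/measurable_EFinP].
have Yfin := integrable_fin_num mD iY.
have inY := integrable_norm iY.
have nfin := integrable_fin_num mD inY.
set m := fine _; pose n := fine (\int[P]_(w in D) (`|Y w|)%:E)%E.
have mn : `|m| <= n.
  rewrite -lee_fin fineK// (_ : `|m|%:E = `|m%:E|)%E// /m fineK//.
  by apply: le_abse_integral => //; exact/measurable_EFinP.
have n0 : 0 <= n by apply: le_trans mn.
apply: (@le_trans _ _ (n `^ p)%:E).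
  by rewrite lee_fin ge0_ler_powR ?nnegrE// ltW.
have [->|nn0] := eqVneq n 0.
  by rewrite powR0 ?gt_eqF//; apply: integral_ge0 => w _; rewrite lee_fin powR_ge0.
have {nn0}ngt0 : 0 < n by rewrite lt0r nn0.
have c0 : 0 <= p * n `^ (p - 1) by rewrite mulr_ge0 ?powR_ge0// ltW.
have : (\int[P]_(w in D) (p * n `^ (p - 1) * `|Y w|)%:E <=
        \int[P]_(w in D) ((p - 1) * n `^ p + `|Y w| `^ p)%:E)%E.
  apply: ge0_le_integral => //.
  - by move=> w _; rewrite lee_fin mulr_ge0.
  - by apply/measurable_EFinP/measurable_funM => //; exact: measurableT_comp.
  - apply/measurable_EFinP/measurable_funD => //.
    exact/measurable_EFinP/mpow.
  - by move=> w _; rewrite lee_fin mulrAC tangent_powR.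
under eq_integral do rewrite EFinM.
under [X in (_ <= X)%E]eq_integral do rewrite EFinD.
have pB0 : 0 <= (p - 1) * n `^ p by rewrite mulr_ge0 ?powR_ge0// subr_ge0.
rewrite ge0_integralZl//; last by apply/measurable_EFinP; exact: measurableT_comp.
rewrite ge0_integralD//; last exact: mpow.
rewrite integral_cst// PD mule1 -(fineK nfin) -/n -EFinM -mulrA.
rewrite [X in p * X]mulrC mulr_powRB1// -leeBlDl// -EFinB.
by rewrite (_ : p * _ - _ = n `^ p)//; ring.
Qed.

(** With [Z = Y - c] one has [Y - E Y = Z - E Z]. Convexity costs [2^(p-1)], and Jensen bounds
    [|E Z|^p] by [E|Z|^p], which contributes the remaining factor 2. *)
Lemma centered_moment_le (Y : T -> R) (c : R) : measurable_fun D Y ->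
  (\int[P]_(w in D) (`|Y w| `^ p)%:E < +oo)%E ->
  (\int[P]_(w in D) (`|Y w - fine (\int[P]_(w in D) (Y w)%:E)| `^ p)%:E <=
   (2 `^ p)%:E * \int[P]_(w in D) (`|Y w - c| `^ p)%:E)%E.
Proof.
move=> mY fin; have iY := integrable_of_moment mY fin.
have Yfin := integrable_fin_num mD iY.
pose Z w := Y w - c.
have iZ : P.-integrable D (EFin \o Z).
  exact: (integrableB mD iY (integrable_cstD c)).
have mZ : measurable_fun D Z by move/integrableP: iZ => [/measurable_EFinP].
set m := fine _.
have mZE : fine (\int[P]_(w in D) (Z w)%:E)%E = m - c.
  rewrite /Z; under eq_integral do rewrite EFinB.
  rewrite integralB//; last exact: integrable_cstD.
  by rewrite integral_cst// PD mule1 fineB.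
have := jensen_norm_powR iZ; rewrite mZE => J.
have q0 : 0 <= 2 `^ (p - 1) :> R by exact: powR_ge0.
apply: (@le_trans _ _ (\int[P]_(w in D)
    ((2 `^ (p - 1))%:E * ((`|Z w| `^ p)%:E + (`|m - c| `^ p)%:E)))%E).
  apply: ge0_le_integral => //.
  - by apply: mpow; exact: measurable_funB.
  - by apply: emeasurable_funM => //; apply: emeasurable_funD => //; exact: mpow.
  - move=> w _; rewrite -EFinD -EFinM lee_fin.
    rewrite (_ : Y w - m = Z w - (m - c)) ?norm_powRB_le//.
    by rewrite /Z; ring.
rewrite ge0_integralZl//; last 2 first.
- by apply: emeasurable_funD => //; exact: mpow.
- by move=> w _; rewrite -EFinD lee_fin addr_ge0 ?powR_ge0.
rewrite ge0_integralD//; last exact: mpow.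
rewrite integral_cst// PD mule1.
have -> : (2 `^ p)%:E = ((2 `^ (p - 1))%:E * (1 + 1))%E :> \bar R.
  by rewrite -EFinD -EFinM mulrC -[1 + 1]/(2 : R) mulr_powRB1.
rewrite -muleA lee_pmul2l ?lte_fin ?powR_gt0//.
by rewrite ge0_muleDl// mul1e leeD2l.
Qed.
End centered_moment.

(** * Assembly of the weighted Poincare inequality *)

Theorem theorem4p1 (R : realType) (d : measure_display) (T : measurableType d)
    (P : probability T R) (X : {RV P >-> R})
    (im ip : \bar R) (f : R -> R) (xbar : R)
    (Hiltr : (im < ip)%E)
    (Hfmeas : measurable_fun setT f)
    (Hdens : forall A : set R, measurable A ->
       distribution P X A = (\int[lebesgue_measure]_(x in A) (f x)%:E)%E)
    (Hfpos : forall x, open_itv im ip x -> 0 < f x)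
    (Hfout : forall x, ~ open_itv im ip x -> f x = 0)
    (Hfac : loc_abs_cont_on (open_itv im ip) f)
    (Hxbar : open_itv im ip xbar)
    (Hmed : cdf_from im f xbar = 1 / 2)
    (p : R) (Hp : 1 <= p) (phi : R -> R)
    (Hphi : smooth_on (open_itv im ip) phi)
    (Hint : (\int[P]_w (`|phi (X w)| `^ p)%:E < +oo)%E) :
  (\int[P]_w (`|phi (X w) - fine ('E_P[phi \o X])| `^ p)%:E
    <= ((2 * p) `^ p)%:E *
       \int[P]_w ((Kfun im f xbar (X w)) `^ p
                  * `|derive1 phi (X w)| `^ p)%:E)%E.
Proof.
set I := open_itv im ip; set A := X @^-1` I.
have f0 x : 0 <= f x.
  by have [/Hfpos/ltW//|/Hfout->] := pselect (I x).
have mI : measurable I by exact: measurable_open_itv.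
have mX : measurable_fun setT X by exact: measurable_funPT.
have mA : measurable A by rewrite -[A]setTI; exact: mX.
have f1 : (\int[lebesgue_measure]_x (f x)%:E = 1)%E.
  by rewrite -Hdens// /distribution /pushforward preimage_setT probability_setT.
(* The density vanishes off [I], so [X] lies in [I] almost surely and all expectations can be
   restricted to [A]. *)
have PAC : P (~` A) = 0%E.
  have := Hdens (~` I) (measurableC mI); rewrite /distribution /pushforward.
  rewrite preimage_setC => ->; apply: integral0_eq => x /= Ix.
  by rewrite Hfout.
have PA : P A = 1%E.
  by rewrite -[A]setCK probability_setC ?PAC ?sube0//; exact: measurableC.
have cf := abs_cont_continuous Hfac.
have dphi x : I x -> is_derive x (1 : R) phi (derive1 phi x).
  by move=> Ix; rewrite derive1E; apply/derivableP; exact: (Hphi 0%N x Ix).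
have cphi' x : I x -> {for x, continuous (derive1 phi)}.
  move=> Ix; apply: differentiable_continuous; apply/derivable1_diffP.
  by have := Hphi 1%N x Ix; rewrite derive1n1.
(* Recentring at the median provides the zero of [u] that the Hardy inequality requires. *)
pose u x := phi x - phi xbar.
have du x : I x -> is_derive x (1 : R) u (derive1 phi x).
  move=> /dphi dx; have := is_deriveB dx (is_derive_cst (phi xbar) x (1 : R)).
  by rewrite subr0.
have mphi : measurable_fun I phi.
  apply: open_continuous_measurable_fun; first exact: open_open_itv.
  move=> x; rewrite inE => /dphi[dx _].
  exact/differentiable_continuous/derivable1_diffP.
have mphi' : measurable_fun I (derive1 phi).
  apply: open_continuous_measurable_fun; first exact: open_open_itv.
  by move=> x; rewrite inE; exact: cphi'.
have mphiX : measurable_fun A (phi \o X).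
  apply: (measurable_comp mI) => //; first by move=> _ [x Ax <-].
  exact: measurable_funTS.
have mpow (h : R -> R) : measurable_fun I h -> measurable_fun I (fun x => h x `^ p).
  exact: (measurableT_comp (measurable_powR p)).
have mnorm (h : R -> R) : measurable_fun I h -> measurable_fun I (fun x => `|h x|).
  by move=> mh; exact: measurableT_comp.
have mu_p : measurable_fun I (fun x => `|u x| `^ p).
  have mu : measurable_fun I u by apply: measurable_funB.
  by apply: mpow; exact: mnorm.
have mKphi' : measurable_fun I
    (fun x => Kfun im f xbar x `^ p * `|derive1 phi x| `^ p).
  by apply: measurable_funM; apply: mpow; [exact: measurable_Kfun|exact: mnorm].
have transfer (h : R -> R) : measurable_fun I h -> (forall x, I x -> 0 <= h x) ->
    (\int[P]_(w in A) (h (X w))%:E = \int[lebesgue_measure]_(x in I) (h x * f x)%:E)%E.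
  move=> mh h0; under [RHS]eq_integral do rewrite EFinM.
  apply: (@ge0_integral_comp_density _ _ _ _ _ P lebesgue_measure X f I (EFin \o h)) => //.
  exact/measurable_EFinP.
rewrite !(integral_full_set _ mA PAC).
have -> : ('E_P[phi \o X] = \int[P]_(w in A) (phi (X w))%:E)%E.
  by rewrite unlock (integral_full_set _ mA PAC).
apply: (le_trans (@centered_moment_le _ _ _ P A p mA PA Hp (phi \o X) (phi xbar)
  mphiX _)).
  by rewrite -(integral_full_set _ mA PAC).
rewrite /= (transfer (fun x => `|u x| `^ p)); last 2 first.
- exact: mu_p.
- by move=> x _; exact: powR_ge0.
rewrite (transfer (fun x => Kfun im f xbar x `^ p * `|derive1 phi x| `^ p)); last 2 first.
- exact: mKphi'.
- by move=> x _; rewrite mulr_ge0 ?powR_ge0.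
have p0 : 0 < p by rewrite (lt_le_trans _ Hp).
(* The factor [2^p] produced by the centring cancels; the remaining [p^p] moves under the integral
   as the Hardy constant. *)
rewrite powRM ?(ltW p0)// EFinM -muleA lee_pmul2l ?lte_fin ?powR_gt0//.
rewrite -ge0_integralZl//; last 3 first.
- by apply/measurable_EFinP/measurable_funM => //; exact: measurable_funTS.
- by move=> x _; rewrite lee_fin !mulr_ge0 ?powR_ge0.
- by rewrite lee_fin powR_ge0.
under [X in (_ <= X)%E]eq_integral do rewrite -EFinM mulrA.
by apply: hardy_median => //; rewrite /u subrr.
Qed.
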